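(* Let the weight $w$ on $\mathbb N_0$ satisfy the discrete Pearson equation $\theta(k+1)w(k+1)=\sigma(k)w(k)$, $k\in\mathbb N_0$, with $\theta,\sigma$ polynomials such that $\theta(0)=0$, $\deg\theta=N+1$, $\deg\sigma=M$, where $\theta$ is monic and $\sigma$ has leading coefficient $\eta$. Then the Laguerre--Freud structure matrix $$\Psi:=\Pi^{-1}H\theta(J^\top)=\sigma(J)H\Pi^\top=\Pi^{-1}\theta(J)H=H\sigma(J^\top)\Pi^\top=\theta(J+I)\Pi^{-1}H=H\Pi^\top\sigma(J^\top-I)$$ (all these expressions being equal) has only $N+M+2$ possibly nonzero diagonals ($N+1$ superdiagonals, the main diagonal and $M$ subdiagonals): $$\Psi=(\Lambda^\top)^M\psi^{(-M)}+\dots+\Lambda^\top\psi^{(-1)}+\psi^{(0)}+\psi^{(1)}\Lambda+\dots+\psi^{(N+1)}\Lambda^{N+1}$$ for some diagonal matrices $\psi^{(k)}$. In particular, the lowest subdiagonal and highest superdiagonal are given by $$(\Lambda^\top)^M\psi^{(-M)}=\eta(J_-)^MH,\qquad \psi^{(-M)}=\eta H\prod_{k=0}^{M-1}T_-^k\gamma=\eta\operatorname{diag}\Big(H_0\prod_{k=1}^M\gamma_k,\;H_1\prod_{k=2}^{M+1}\gamma_k,\dots\Big),$$ $$\psi^{(N+1)}\Lambda^{N+1}=H(J_-^\top)^{N+1},\qquad \psi^{(N+1)}=H\prod_{k=0}^{N}T_-^k\gamma=\operatorname{diag}\Big(H_0\prod_{k=1}^{N+1}\gamma_k,\;H_1\prod_{k=2}^{N+2}\gamma_k,\dots\Big).$$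 The vector $P(z)$ of orthogonal polynomials fulfills the structure equations $$\theta(z)P(z-1)=\Psi H^{-1}P(z),\qquad \sigma(z)P(z+1)=\Psi^\top H^{-1}P(z).$$
   Context: $\mathbb N_0=\{0,1,2,\dots\}$; all matrices are semi-infinite with rows and columns indexed by $\mathbb N_0$. The weight has finite moments $\rho_n=\sum_{k=0}^\infty k^nw(k)$ (absolutely convergent) and moment matrix $G=(\rho_{n+m})_{n,m\in\mathbb N_0}$, all of whose leading principal minors are assumed to be nonzero, so that $G=S^{-1}HS^{-\top}$ uniquely with $S$ lower unitriangular and $H=\operatorname{diag}(H_0,H_1,\dots)$, $H_n\ne0$. With $\chi(z)=(1,z,z^2,\dots)^\top$, $P(z)=S\chi(z)=(P_0(z),P_1(z),\dots)^\top$ is the vector of monic orthogonal polynomials. $\Lambda$ is the shift matrix with ones on the first superdiagonal and zeros elsewhere. $J=S\Lambda S^{-1}$ is the Jacobi matrix; it is tridiagonal, $J=\Lambda^\top\gamma+\beta+\Lambda$ with $\gamma=\operatorname{diag}(\gamma_1,\gamma_2,\dots)$, $\beta=\operatorname{diag}(\beta_0,\beta_1,\dots)$, $\gamma_n=H_n/H_{n-1}$; its strictly lower triangular part is $J_-=\Lambda^\top\gamma$. $B$ is the lower Pascal matrix, $B_{n,m}=\binom nm$ for $n\ge m$ and $0$ otherwise, and $\Pi=SBS^{-1}$ (so $P(z\pm1)=\Pi^{\pm1}P(z)$). $T_-$ is the lowering shift on diagonal matrices: $T_-\operatorname{diag}(a_0,a_1,\dots)=\operatorname{diag}(a_1,a_2,\dots)$.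 *)

(* Defs.v *)
From mathcomp Require Import all_boot all_order all_algebra.
From mathcomp Require Import all_classical all_reals all_analysis.
From mathcomp Require Export complex.

Set Implicit Arguments.
Unset Strict Implicit.
Unset Printing Implicit Defensive.

Import Order.TTheory GRing.Theory Num.Theory numFieldNormedType.Exports.

Local Open Scope classical_set_scope.
Local Open Scope ring_scope.

(* Semi-infinite matrices and vectors are plain functions out of nat, so that
   0, +, - and \sum are the pointwise operations on functions. *)
Notation smx K := (nat -> nat -> K) (only parsing).

Section SemiInfinite.
Variable K : fieldType.
Implicit Types (A B S : smx K) (d h : nat -> K) (p : {poly K}).

Definition sscale (c : K) A : smx K := fun n m => c * A n m.

Definition sdiag d : smx K := fun n m => if n == m then d n else 0.

Definition sone : smx K := sdiag (fun=> 1).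

Definition strmx A : smx K := fun n m => A m n.

(* The entries of a product are finitely supported sums.  \sum_(k \in _) is 0
   on an infinite support, but every product formed from S, H, J, Pi, theta(J)
   and their inverses and transposes in the order in which they are used below
   has a row-finite left factor or a column-finite right factor. *)
Definition smul A B : smx K :=
  fun n m => \sum_(k \in [set: nat]) (A n k * B k m).

Definition smulv A (x : nat -> K) : nat -> K :=
  fun n => \sum_(k \in [set: nat]) (A n k * x k).

Definition spow A (i : nat) : smx K := iter i (smul A) sone.

Definition speval p A : smx K := \sum_(i < size p) sscale p`_i (spow A i).

(* The two-sided inverse (0 if there is none).  It is unique when A is
   triangular with nonzero diagonal, the only case in which it is used. *)
Definition sinv A : smx K :=
  xget (fun _ _ => 0) [set X : smx K | smul A X = sone /\ smul X A = sone].

Definition lower_unitriangular A : Prop :=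
  (forall n, A n n = 1) /\ (forall n m, (n < m)%N -> A n m = 0).

Definition strict_lower A : smx K := fun n m => if (m < n)%N then A n m else 0.

Definition sshift : smx K := fun n m => if m == n.+1 then 1 else 0.

Definition pascal : smx K := fun n m => 'C(n, m)%:R.

(* On a diagonal matrix this is T_- diag(a_0, a_1, ...) = diag(a_1, a_2, ...) *)
Definition Tminus A : smx K := fun n m => A n.+1 m.+1.

Definition monomials (z : K) : nat -> K := fun n => z ^+ n.

Definition leading_minor A (n : nat) : K :=
  \det (\matrix_(i < n, j < n) A i j).

(* G = S^-1 H S^-T with H = diag(h_0, h_1, ...).  Such S and h exist and are
   unique when the leading principal minors of G are nonzero. *)
Definition cholesky (G : smx K) S h : Prop :=
  [/\ lower_unitriangular S, forall n, h n != 0 &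
      G = smul (smul (sinv S) (sdiag h)) (strmx (sinv S))].

Definition orth_poly S (z : K) : nat -> K := smulv S (monomials z).

Definition jacobi S : smx K := smul (smul S sshift) (sinv S).

Definition dressed_pascal S : smx K := smul (smul S pascal) (sinv S).

Definition gamma_ h (n : nat) : K := h n / h n.-1.

Definition gamma_mx h : smx K := sdiag (fun n => gamma_ h n.+1).

End SemiInfinite.

Arguments sone {K}.
Arguments sshift {K}.
Arguments smul {K}.

Declare Scope smx_scope.
Delimit Scope smx_scope with smx.
Notation "A ** B" := (smul A B) (at level 40, left associativity) : smx_scope.
Notation "A '^^' n" := (spow A n) (at level 30) : smx_scope.
Notation "A '^tr'" := (strmx A) (at level 2, format "A '^tr'") : smx_scope.
Notation "c *:: A" := (sscale c A) (at level 40) : smx_scope.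

Section Weight.
Variable K : numFieldType.
Implicit Type w : nat -> K.

Definition has_finite_moments w : Prop :=
  forall n, cvgn (series (fun k => `|k%:R ^+ n * w k| : K)).

Definition moment w (n : nat) : K :=
  limn (series (fun k => k%:R ^+ n * w k : K)).

Definition moment_mx w : smx K := fun n m => moment w (n + m)%N.

Definition pearson w (theta sigma : {poly K}) : Prop :=
  forall k : nat, theta.[k.+1%:R] * w k.+1 = sigma.[k%:R] * w k.

End Weight.

(* Main.v *)
(** Pearson's equation and summation by shift give
    [theta(L) G = B sigma(L) G B^T] for the Hankel moment matrix
    [G = S^-1 H S^-T], the boundary term at [k = 0] vanishing because
    [theta(0) = 0].  Conjugating by [S] turns it into
    [theta(J) H = Pi sigma(J) H Pi^T], and [L G = G L^T] into [J H = H J^T];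
    together with [J Pi = Pi (J + I)] these yield all six expressions of [Psi].
    Since [Pi] is lower unitriangular and [J] is lower Hessenberg with unit
    superdiagonal, [Psi H^-1 = Pi^-1 theta(J)] vanishes above the superdiagonal
    [N + 1], where it is [1], and [Psi^T H^-1 = Pi sigma(J)] above the
    superdiagonal [M], where it is [eta].  The structure equations follow by
    applying both to [P(z)], an eigenvector of [J] shifted by [Pi]. *)
Require Import Defs.
From mathcomp Require Import all_boot all_order all_algebra.
From mathcomp Require Import all_classical all_reals all_analysis.
From mathcomp Require Import zify.
Import Order.TTheory GRing.Theory Num.Theory numFieldNormedType.Exports.
Local Open Scope ring_scope.
Local Open Scope smx_scope.

(** * Semi-infinite matrices *)

Section Algebra.
Set Implicit Arguments.
Unset Strict Implicit.
Variable K : fieldType.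
Implicit Types (A B C D X : smx K) (d e : nat -> K) (p : {poly K}).

Lemma smxP A B : (forall n m, A n m = B n m) -> A = B.
Proof. by move=> AB; apply/funext => n; apply/funext => m; exact: AB. Qed.

Lemma fsum_nat (f : nat -> K) b : (forall k, (b <= k)%N -> f k = 0) ->
  \sum_(k \in [set: nat]%classic) f k = \sum_(k < b) f k.
Proof.
move=> f0; rewrite fsbig_ord; apply/esym/fsbig_widen => // k [_] /= /negP.
by rewrite -leqNgt => /f0.
Qed.

Lemma smul_nat A B n m b : (forall k, (b <= k)%N -> A n k * B k m = 0) ->
  (A ** B) n m = \sum_(k < b) A n k * B k m.
Proof. exact: fsum_nat. Qed.

Lemma smul_single A B n m k0 : (forall k, k != k0 -> A n k * B k m = 0) ->
  (A ** B) n m = A n k0 * B k0 m.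
Proof.
move=> AB0; rewrite (@smul_nat _ _ _ _ k0.+1) => [|k lk]; last first.
  by apply: AB0; rewrite gtn_eqF.
rewrite big_ord_recr /= big1 ?add0r// => k _.
by apply: AB0; rewrite ltn_eqF.
Qed.

Definition row_finite A :=
  forall n, exists b, forall k, (b <= k)%N -> A n k = 0.

Definition col_finite A := row_finite A^tr.

Lemma smul_nat_row A n b : (forall k, (b <= k)%N -> A n k = 0) ->
  forall B m, (A ** B) n m = \sum_(k < b) A n k * B k m.
Proof. by move=> A0 B m; apply: smul_nat => k /A0 ->; rewrite mul0r. Qed.

(** An entry of a product meets only finitely many rows of its second factor; their bounds have a
    maximum. *)
Lemma row_finite_uniform A : row_finite A ->
  forall b, exists c, forall n k, (n < b)%N -> (c <= k)%N -> A n k = 0.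
Proof.
move=> rfA; elim=> [|b [c Ac]]; first by exists 0.
have [c' Ac'] := rfA b; exists (maxn c c') => n k.
rewrite ltnS geq_max leq_eqVlt => /orP[/eqP->|nb] /andP[ck c'k].
  exact: Ac'.
exact: Ac.
Qed.

(* [smul] is not associative in general: sums with infinite support are [0]. *)
Lemma smulA_entry A B C n m b c :
  (forall k, (b <= k)%N -> A n k = 0) ->
  (forall k j, (k < b)%N -> (c <= j)%N -> B k j * C j m = 0) ->
  (A ** (B ** C)) n m = (A ** B ** C) n m.
Proof.
move=> A0 BC0; rewrite (smul_nat_row A0).
rewrite (@smul_nat _ _ _ _ c) => [|j cj]; last first.
  rewrite (smul_nat_row A0) mulr_suml big1// => k _.
  by rewrite -mulrA BC0 ?mulr0.
under [RHS]eq_bigr do rewrite (smul_nat_row A0) mulr_suml.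
rewrite exchange_big /=; apply: eq_bigr => k _.
rewrite (@smul_nat _ _ _ _ c) => [|j]; last exact: BC0.
by rewrite mulr_sumr; apply: eq_bigr => j _; rewrite mulrA.
Qed.

Lemma smulA_rr A B C : row_finite A -> row_finite B ->
  A ** (B ** C) = A ** B ** C.
Proof.
move=> rfA rfB; apply: smxP => n m.
have [b A0] := rfA n; have [c B0] := row_finite_uniform rfB b.
by apply: (smulA_entry (c := c) A0) => k j kb cj; rewrite (B0 k j) ?mul0r.
Qed.

(** Row [n] of [A] and column [m] of [C] bound both summations, so the middle factor may be full, as
    the moment matrix is. *)
Lemma smulA_rc A B C : row_finite A -> col_finite C ->
  A ** (B ** C) = A ** B ** C.
Proof.
move=> rfA cfC; apply: smxP => n m.
have [b A0] := rfA n; have [c C0] := cfC m.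
apply: (smulA_entry (c := c) A0) => k j kb /C0.
by rewrite /strmx => ->; rewrite mulr0.
Qed.

Lemma strmxK A : A^tr^tr = A. Proof. by []. Qed.

Lemma strmx_mul A B : (A ** B)^tr = B^tr ** A^tr.
Proof.
apply: smxP => n m; rewrite /strmx /smul.
by apply: eq_fsbigr => k _; rewrite mulrC.
Qed.

(** The transpose of [smulA_rr]. *)
Lemma smulA_cc A B C : col_finite B -> col_finite C ->
  A ** (B ** C) = A ** B ** C.
Proof.
move=> cfB cfC; rewrite -[RHS]strmxK.
have -> : (A ** B ** C)^tr = C^tr ** (B^tr ** A^tr).
  by rewrite (strmx_mul _ C) (strmx_mul A).
by rewrite (@smulA_rr C^tr)// -(strmx_mul B C) -(strmx_mul A (B ** C)).
Qed.

Lemma row_finite_mul A B : row_finite A -> row_finite B ->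
  row_finite (A ** B).
Proof.
move=> rfA rfB n; have [b A0] := rfA n.
have [c B0] := row_finite_uniform rfB b.
exists c => j cj; rewrite (smul_nat_row A0) big1// => k _.
by rewrite B0 ?mulr0.
Qed.

Lemma smul_diagr A d n m : (A ** sdiag d) n m = A n m * d m.
Proof.
rewrite (@smul_single _ _ _ _ m) /sdiag ?eqxx// => k /negPf ->.
by rewrite mulr0.
Qed.

Lemma smul_diagl d A n m : (sdiag d ** A) n m = d n * A n m.
Proof.
rewrite (@smul_single _ _ _ _ n) /sdiag ?eqxx// => k; rewrite eq_sym => /negPf ->.
by rewrite mul0r.
Qed.

Lemma strmx_diag d : (sdiag d)^tr = sdiag d.
Proof.
by apply: smxP => n m; rewrite /strmx /sdiag eq_sym; case: eqP => // ->.
Qed.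

Lemma strmx1 : sone^tr = sone :> smx K. Proof. exact: strmx_diag. Qed.

Lemma row_finite_add A B : row_finite A -> row_finite B -> row_finite (A + B).
Proof.
move=> rfA rfB n; have [b A0] := rfA n; have [c B0] := rfB n.
exists (maxn b c) => k; rewrite geq_max => /andP[bk ck].
by rewrite -[LHS]/(A n k + B n k) A0 ?B0 ?addr0.
Qed.

Lemma row_finite_opp A : row_finite A -> row_finite (- A).
Proof.
move=> rfA n; have [b A0] := rfA n.
by exists b => k /A0 An; rewrite -[LHS]/(- A n k) An oppr0.
Qed.

Lemma row_finite_diag d : row_finite (sdiag d).
Proof. by move=> n; exists n.+1 => k nk; rewrite /sdiag ltn_eqF. Qed.

Lemma col_finite_diag d : col_finite (sdiag d).
Proof. by rewrite /col_finite strmx_diag; exact: row_finite_diag. Qed.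

Lemma smul_diag d e : sdiag d ** sdiag e = sdiag (d * e).
Proof.
by apply: smxP => n m; rewrite smul_diagr /sdiag; case: eqP => [->|]; rewrite ?mul0r.
Qed.

Lemma smul1 A : sone ** A = A.
Proof. by apply: smxP => n m; rewrite smul_diagl mul1r. Qed.

Lemma smulr1 A : A ** sone = A.
Proof. by apply: smxP => n m; rewrite smul_diagr mulr1. Qed.

(** * Powers and polynomials of row-finite matrices *)

Lemma row_finite_pow A k : row_finite A -> row_finite (A ^^ k).
Proof.
move=> rfA; elim: k => [|k IH]; first exact: row_finite_diag.
exact: row_finite_mul.
Qed.

Lemma smul_sumr A (I : Type) (r : seq I) (c : I -> K) (F : I -> smx K) n m :
  row_finite A ->
  (A ** \sum_(i <- r) sscale (c i) (F i)) n m
    = \sum_(i <- r) c i * (A ** F i) n m.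
Proof.
move=> rfA; have [b A0] := rfA n; rewrite (smul_nat_row A0).
under [RHS]eq_bigr do rewrite (smul_nat_row A0) mulr_sumr.
rewrite exchange_big /=; apply: eq_bigr => k _.
rewrite 2!fct_sumE mulr_sumr; apply: eq_bigr => i _.
by rewrite /sscale mulrCA.
Qed.

Lemma spevalE p A n m :
  (speval p A) n m = \sum_(i < size p) p`_i * (A ^^ i) n m.
Proof. by rewrite /speval 2!fct_sumE. Qed.

Lemma row_finite_pow_uniform A : row_finite A -> forall s n,
  exists b, forall i k, (i < s)%N -> (b <= k)%N -> (A ^^ i) n k = 0.
Proof.
move=> rfA s n; elim: s => [|s [b A0]]; first by exists 0.
have [b' A0'] := @row_finite_pow A s rfA n.
exists (maxn b b') => i k; rewrite ltnS geq_max leq_eqVlt.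
by move=> /orP[/eqP->|is_] /andP[bk b'k]; [exact: A0' | exact: A0].
Qed.

Lemma row_finite_eval A p : row_finite A -> row_finite (speval p A).
Proof.
move=> rfA n.
have [b A0] := row_finite_pow_uniform rfA (size p) n.
exists b => k bk; rewrite spevalE big1// => i _.
by rewrite A0 ?mulr0.
Qed.

Lemma speval_mul p A B n m : row_finite A ->
  (speval p A ** B) n m = \sum_(i < size p) p`_i * (A ^^ i ** B) n m.
Proof.
move=> rfA.
have [b A0] := row_finite_pow_uniform rfA (size p) n.
rewrite (@smul_nat_row _ _ b) => [|k bk]; last first.
  by rewrite spevalE big1// => i _; rewrite A0 ?mulr0.
under [LHS]eq_bigr do rewrite spevalE mulr_suml.
rewrite exchange_big /=; apply: eq_bigr => i _.
rewrite (@smul_nat_row _ _ b) => [|k bk]; last by rewrite A0.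
by rewrite mulr_sumr; apply: eq_bigr => k _; rewrite mulrA.
Qed.

Lemma spowSr A k : row_finite A -> A ^^ k.+1 = A ^^ k ** A.
Proof.
move=> rfA; elim: k => [|k IH]; first by rewrite /spow /= smul1 smulr1.
rewrite -[LHS]/(A ** A ^^ k.+1) {1}IH smulA_rr//; exact: row_finite_pow.
Qed.

Lemma strmx_pow A k : row_finite A -> (A ^^ k)^tr = A^tr ^^ k.
Proof.
move=> rfA; elim: k => [|k IH]; first exact: strmx1.
by rewrite spowSr// strmx_mul IH.
Qed.

Lemma strmx_eval A p : row_finite A -> (speval p A)^tr = speval p A^tr.
Proof.
move=> rfA; apply: smxP => n m; rewrite /strmx !spevalE.
by apply: eq_bigr => i _; rewrite -(strmx_pow i rfA).
Qed.

(** The two alternatives are what reassociating [X ** B ^^ k] takes. The first serves [S] and [Pi],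
    the second [B = J^tr] and diagonal [B], where [X] may have infinite rows. *)
Lemma spow_intertwine A B X k : row_finite A ->
  (row_finite X /\ row_finite B) \/ col_finite B ->
  A ** X = X ** B -> A ^^ k ** X = X ** B ^^ k.
Proof.
move=> rfA XB AX; elim: k => [|k IH]; first by rewrite smul1 smulr1.
have rfAk := @row_finite_pow A k rfA.
rewrite /= -smulA_rr// IH.
case: XB => [[rfX rfB]|cfB]; first by rewrite smulA_rr// AX smulA_rr.
have cfBk : col_finite (B ^^ k).
  have := @strmx_pow B^tr k cfB; rewrite strmxK /col_finite => <-.
  exact: (@row_finite_pow B^tr).
by rewrite smulA_rc// AX smulA_cc.
Qed.

Lemma speval_intertwine A B X p : row_finite A ->
  (row_finite X /\ row_finite B) \/ col_finite B ->
  A ** X = X ** B -> speval p A ** X = X ** speval p B.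
Proof.
move=> rfA XB AX; apply: smxP => n m; rewrite speval_mul//.
under eq_bigr do rewrite (spow_intertwine _ _ XB)//.
case: XB => [[rfX rfB]|cfB]; first by rewrite smul_sumr.
(* [X] may have infinite rows here; after transposition the polynomial is a row-finite left factor
   and [speval_mul] applies. *)
have := strmx_eval p cfB; rewrite strmxK => <-.
have -> : X ** (speval p B^tr)^tr = (speval p B^tr ** X^tr)^tr.
  by rewrite (strmx_mul (speval p B^tr) X^tr).
rewrite [RHS]speval_mul//; apply: eq_bigr => i _; congr (_ * _).
have := strmx_pow i cfB; rewrite strmxK => <-.
by rewrite -[LHS]/((_ ** _)^tr m n) strmx_mul.
Qed.

End Algebra.

(** * Lower Hessenberg matrices *)

Section Hessenberg.
Set Implicit Arguments.
Unset Strict Implicit.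
Variable K : fieldType.
Implicit Types (A B C D X : smx K) (d e : nat -> K) (p : {poly K}).

Lemma smulDl A B C : row_finite A -> row_finite B ->
  (A + B) ** C = A ** C + B ** C.
Proof.
move=> rfA rfB; apply: smxP => n m; have [b A0] := rfA n; have [c B0] := rfB n.
have A0' k : (maxn b c <= k)%N -> A n k = 0 by rewrite geq_max => /andP[/A0].
have B0' k : (maxn b c <= k)%N -> B n k = 0 by rewrite geq_max => /andP[_ /B0].
rewrite -[RHS]/((A ** C) n m + (B ** C) n m).
rewrite (smul_nat_row A0') (smul_nat_row B0') -big_split /=.
rewrite (@smul_nat_row _ _ _ (maxn b c)) => [|k bk].
  by apply: eq_bigr => k _; rewrite -mulrDl.
by rewrite -[LHS]/(A n k + B n k) A0' ?B0' ?addr0.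
Qed.

Lemma smulDr A B C : row_finite A -> A ** (B + C) = A ** B + A ** C.
Proof.
move=> rfA; apply: smxP => n m; have [b A0] := rfA n.
rewrite -[RHS]/((A ** B) n m + (A ** C) n m) !(smul_nat_row A0) -big_split /=.
by apply: eq_bigr => k _; rewrite -mulrDr.
Qed.

(** The pair [a], [c] behaves like a degree and a leading coefficient: under products the widths add
    and the constants multiply. *)
Definition hessenberg (a : nat) (c : K) A :=
  (forall n m, (n + a < m)%N -> A n m = 0) /\ forall n, A n (n + a)%N = c.

Lemma hess_row_finite a c A : hessenberg a c A -> row_finite A.
Proof. by move=> [A0 _] n; exists (n + a).+1 => k /A0. Qed.

Lemma hess_mul a b (c d : K) A B : hessenberg a c A -> hessenberg b d B ->
  hessenberg (a + b) (c * d) (A ** B).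
Proof.
move=> [A0 Ac] [B0 Bd].
split=> [n m nm|n]; rewrite (@smul_nat_row _ _ _ (n + a).+1) => [|k /A0//].
- rewrite big1// => -[k /= kn] _; rewrite B0 ?mulr0//; lia.
- rewrite big_ord_recr big1 => [|[k /= kn] _]; last by rewrite B0 ?mulr0//; lia.
  by rewrite /= Ac addnA Bd add0r.
Qed.

Lemma hess1 : hessenberg 0 1 (sone : smx K).
Proof.
by split=> [n m|n]; rewrite addn0 /sone /sdiag ?eqxx// => nm; rewrite ltn_eqF.
Qed.

Lemma hess_pow c A k : hessenberg 1 c A -> hessenberg k (c ^+ k) (A ^^ k).
Proof.
move=> hA; elim: k => [|k IH]; first exact: hess1.
by rewrite exprS; exact: (hess_mul hA IH).
Qed.

(** Powers of [A] below the [s]-th vanish on superdiagonal [s], so only the leading term of [p]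
    reaches it. *)
Lemma hess_eval p s A : hessenberg 1 1 A -> size p = s.+1 ->
  hessenberg s (lead_coef p) (speval p A).
Proof.
move=> hA sp; split=> [n m nm|n]; rewrite spevalE sp.
  rewrite big1// => -[i /= si] _; rewrite (hess_pow i hA).1 ?mulr0//; lia.
rewrite big_ord_recr big1 /= => [|[i /= si] _].
  by rewrite (hess_pow s hA).2 expr1n mulr1 add0r lead_coefE sp.
by rewrite (hess_pow i hA).1 ?mulr0//; lia.
Qed.

Lemma hess_unitriangular A : lower_unitriangular A <-> hessenberg 0 1 A.
Proof.
by split=> -[A1 A2]; split=> n; try move=> m; have := A1 n; have := A2 n;
  rewrite !addn0; auto.
Qed.

(** * Inverses of unitriangular and diagonal matrices *)

Lemma lower_unitriangular_inverse A : lower_unitriangular A ->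
  exists X, [/\ hessenberg 0 1 X, A ** X = sone & X ** A = sone].
Proof.
move=> [A1 A0].
have rfA : row_finite A by move=> n; exists n.+1 => k /A0.
(* Neumann series: [D] is strictly lower triangular, so the sum of its powers
   is finite in every entry. *)
pose D : smx K := sone - A.
have D0 n m : (n <= m)%N -> D n m = 0.
  rewrite leq_eqVlt -[D n m]/(sone n m - A n m) /sone /sdiag.
  by move=> /orP[/eqP->|nm]; rewrite ?eqxx ?A1 ?subrr// ltn_eqF ?A0 ?subrr.
have rfD : row_finite D by move=> n; exists n => k /D0.
have Dk0 k n m : (n < m + k)%N -> (D ^^ k) n m = 0.
  elim: k n m => [|k IH] n m.
    by rewrite addn0 => nm; apply: hess1.1; rewrite addn0.
  move=> nm; rewrite [_ ^^ _]/= (@smul_nat_row _ _ _ n) => [|j /D0//].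
  by rewrite big1// => -[j /= jn] _; rewrite IH ?mulr0//; lia.
have AD : A + D = sone by rewrite /D addrC subrK.
have ADk k : A ** D ^^ k = D ^^ k - D ^^ k.+1.
  by apply/eqP; rewrite eq_sym subr_eq -smulDl// AD smul1.
have DkA k : D ^^ k ** A = D ^^ k - D ^^ k.+1.
  have rfDk := @row_finite_pow _ D k rfD.
  by apply/eqP; rewrite eq_sym subr_eq spowSr// -smulDr// AD smulr1.
pose X : smx K := fun n m => \sum_(k < n.+1) (D ^^ k) n m.
(* Row [n] of [D ^^ k] is zero for [k > n], so rows of [X] can be summed to a common length and the
   sums exchanged below. *)
have XE b n m : (n < b)%N -> X n m = \sum_(k < b) (D ^^ k) n m.
  elim: b => // b IH; rewrite ltnS leq_eqVlt => /orP[/eqP<-//|nb].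
  by rewrite big_ord_recr /= Dk0 ?addr0 ?IH//; lia.
(* What remains is [D ^^ 0 - D ^^ n.+1], whose second term vanishes in row [n]. *)
have tele n m : \sum_(k < n.+1) ((D ^^ k) n m - (D ^^ k.+1) n m) = sone n m.
  rewrite -(big_mkord xpredT (fun k => (D ^^ k) n m - (D ^^ k.+1) n m)).
  rewrite (@telescope_sumr_eq _ _ _ (fun k => - (D ^^ k) n m)) => [|//|k _].
    by rewrite Dk0 ?oppr0 ?sub0r ?opprK//; lia.
  by rewrite opprK addrC.
have X0 n m : (n < m)%N -> X n m = 0.
  by move=> nm; rewrite /X big1// => k _; rewrite Dk0//; lia.
exists X; split.
- split=> [n m|n]; rewrite addn0; first exact: X0.
  rewrite /X big_ord_recl big1 => [|k _]; last by rewrite lift0 Dk0//; lia.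
  by rewrite /= /sone /sdiag eqxx addr0.
- apply: smxP => n m; rewrite (@smul_nat_row _ _ _ n.+1) => [|k /A0//].
  rewrite -tele; under eq_bigr => j _ do rewrite (XE n.+1)// mulr_sumr.
  rewrite exchange_big /=; apply: eq_bigr => k _.
  rewrite -[RHS]/((D ^^ k - D ^^ k.+1) n m) -ADk.
  by rewrite [RHS](@smul_nat_row _ _ _ n.+1) => [|j /A0].
- apply: smxP => n m; rewrite (@smul_nat_row _ _ _ n.+1) => [|k /X0//].
  rewrite -tele; under eq_bigr => j _ do rewrite /X mulr_suml.
  rewrite exchange_big /=; apply: eq_bigr => k _.
  rewrite -[RHS]/((D ^^ k - D ^^ k.+1) n m) -DkA.
  by rewrite [RHS](@smul_nat_row _ _ _ n.+1) => [//|j nj]; rewrite Dk0//; lia.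
Qed.

(** Reassociating [X ** (A ** Y)] uses row-finiteness of [X] and [A] alone, so it covers every
    competing inverse [Y]. *)
Lemma sinv_unique A X : row_finite A -> row_finite X ->
  A ** X = sone -> X ** A = sone -> sinv A = X.
Proof.
move=> rfA rfX AX XA; apply: xget_unique => // Y [AY _].
by rewrite -[LHS]smul1 -XA -smulA_rr// AY smulr1.
Qed.

Lemma sinv_unitriangular A : lower_unitriangular A ->
  [/\ hessenberg 0 1 (sinv A), A ** sinv A = sone & sinv A ** A = sone].
Proof.
move=> uA; have [X [hX AX XA]] := lower_unitriangular_inverse uA.
have /hess_unitriangular/hess_row_finite rfA := uA.
by rewrite (sinv_unique rfA (hess_row_finite hX) AX XA).
Qed.

Lemma sinv_diag d : (forall n, d n != 0) ->
  sinv (sdiag d) = sdiag (fun n => (d n)^-1).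
Proof.
move=> d0; apply: sinv_unique; rewrite ?smul_diag; try exact: row_finite_diag.
  by congr sdiag; apply/funext => n; rewrite -[LHS]/(d n * (d n)^-1) divff.
by congr sdiag; apply/funext => n; rewrite -[LHS]/((d n)^-1 * d n) mulVf.
Qed.

(** * The shift and Pascal matrices *)

Lemma hess_shift : hessenberg 1 1 (sshift : smx K).
Proof.
by split=> [n m|n]; rewrite addn1 /sshift ?eqxx// => nm; rewrite gtn_eqF.
Qed.

Lemma smul_shiftl A n m : (sshift ** A) n m = A n.+1 m.
Proof.
rewrite (@smul_single _ _ _ _ _ n.+1) /sshift ?eqxx ?mul1r// => k /negPf ->.
by rewrite mul0r.
Qed.

Lemma smul_shift_pow k A n m : (sshift ^^ k ** A) n m = A (n + k)%N m.
Proof.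
elim: k n => [|k IH] n; first by rewrite smul1 addn0.
have rfL := hess_row_finite hess_shift.
rewrite -[_ ^^ _]/(sshift ** sshift ^^ k) -smulA_rr//; last exact: row_finite_pow.
by rewrite smul_shiftl IH addSnnS.
Qed.

Lemma shift_powE k n m : (sshift ^^ k : smx K) n m = (m == n + k)%N%:R.
Proof.
by rewrite -[_ ^^ k]smulr1 smul_shift_pow /sone /sdiag eq_sym; case: eqP.
Qed.

Lemma hess_pascal : hessenberg 0 1 (pascal K).
Proof.
by split=> [n m|n]; rewrite addn0 /pascal ?binn// => nm; rewrite bin_small.
Qed.

(** Entrywise this is Pascal's rule; column 0 is apart because [sshift] has an empty column
    there. *)
Lemma shift_pascal : sshift ** pascal K = pascal K ** (sshift + sone).
Proof.
rewrite smulDr ?smulr1; last exact: hess_row_finite hess_pascal.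
apply: smxP => n m; rewrite smul_shiftl.
rewrite -[RHS]/((pascal K ** sshift) n m + pascal K n m).
case: m => [|m]; last first.
  rewrite (@smul_single _ _ _ _ _ m) /sshift ?eqxx.
    by rewrite mulr1 /pascal binS natrD addrC.
  by move=> k km; rewrite eqSS eq_sym (negPf km) mulr0.
rewrite (@smul_nat_row _ _ _ n.+1) => [|k nk]; last by rewrite /pascal bin_small.
by rewrite big1 ?add0r => [|k _]; rewrite /pascal ?bin0// /sshift mulr0.
Qed.

End Hessenberg.

(** * Diagonals of band matrices *)

Section Diagonals.
Set Implicit Arguments.
Unset Strict Implicit.
Variable K : fieldType.
Implicit Types (A : smx K) (d h : nat -> K).

(** Superdiagonals are indexed by row and subdiagonals by column, since the diagonal factor stands
    left of [sshift ^^ k] but right of [sshift^tr ^^ k]. [Negz k] is [-(k + 1)]. *)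
Definition band_diagonal A (z : int) (n : nat) : K :=
  match z with Posz k => A n (n + k)%N | Negz k => A (n + k.+1)%N n end.

(** For [k = 0] the index is [Posz 0], where both conventions agree; this covers constant
    [sigma]. *)
Lemma band_diagonalN A k n : band_diagonal A (- k%:Z) n = A (n + k)%N n.
Proof. by case: k => [|k]; rewrite ?oppr0 //= addn0. Qed.

(** The test is put on [k] so that a sum over [k] collapses to one term; the factor [n <= m]
    corrects the truncated subtraction. *)
Lemma diag_mul_shift_pow k d n m :
  (sdiag d ** sshift ^^ k) n m = if k == (m - n)%N then (n <= m)%N%:R * d n else 0.
Proof.
rewrite smul_diagl shift_powE.
case: (leqP n m) => nm; last first.
  by rewrite mul0r if_same [m == _](_ : _ = false) ?mulr0//; lia.
rewrite mul1r [m == _](_ : _ = (k == m - n)%N); last lia.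
by case: eqP => _; rewrite ?mulr1 ?mulr0.
Qed.

Lemma shift_tr_pow_mul_diag k d n m :
  (sshift^tr ^^ k ** sdiag d) n m = if k == (n - m)%N then (m <= n)%N%:R * d m else 0.
Proof.
rewrite -[LHS]/((_ ** _)^tr m n) strmx_mul strmx_diag.
rewrite -(strmx_pow k (hess_row_finite (hess_shift K))) strmxK.
exact: diag_mul_shift_pow.
Qed.

Lemma band_expansion A a b :
  (forall n m, (m + a < n)%N -> A n m = 0) ->
  (forall n m, (n + b < m)%N -> A n m = 0) ->
  A = \sum_(1 <= k < a.+1) (sshift^tr ^^ k ** sdiag (band_diagonal A (- k%:Z)))
      + sdiag (band_diagonal A 0)
      + \sum_(1 <= k < b.+1) (sdiag (band_diagonal A k%:Z) ** sshift ^^ k).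
Proof.
move=> Aa Ab; apply: smxP => n m.
set X := (X in _ = (X + _ + _) n m); set Y := (Y in _ = (_ + _ + Y) n m).
rewrite -[RHS]/(X n m + sdiag (band_diagonal A 0) n m + Y n m).
rewrite /X /Y !fct_sumE.
under eq_bigr do rewrite shift_tr_pow_mul_diag.
under [X in _ = _ + X]eq_bigr do rewrite diag_mul_shift_pow.
rewrite -!big_mkcond !big_nat1_eq /sdiag !ltnS band_diagonalN /=.
case: (ltngtP n m) => [nm|mn|->].
- rewrite (_ : 0 < n - m = false)%N; last lia.
  rewrite !add0r subn_gt0 nm /= mul1r subnKC ?(ltnW nm)//.
  by case: leqP => // ?; rewrite Ab//; lia.
- rewrite (_ : 0 < m - n = false)%N; last lia.
  rewrite !addr0 subn_gt0 mn /= mul1r subnKC ?(ltnW mn)//.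
  by case: leqP => // ?; rewrite Aa//; lia.
- by rewrite subnn add0r addr0 addn0.
Qed.

Lemma Tminus_iter_diag k d : iter k (@Tminus K) (sdiag d) = sdiag (fun n => d (n + k)%N).
Proof.
elim: k => [|k IH] /=; first by congr sdiag; apply/funext => n; rewrite addn0.
by rewrite IH; apply: smxP => n m; rewrite /Tminus /sdiag eqSS addSnnS.
Qed.

(** The quotients [h i / h i.-1] telescope; from [n.+1] on, the predecessor is never truncated. *)
Lemma gamma_prod h n k : (forall i, h i != 0) ->
  h n * \prod_(n.+1 <= i < (n + k).+1) gamma_ h i = h (n + k)%N.
Proof.
move=> h0; elim: k => [|k IH]; first by rewrite addn0 big_geq ?mulr1.
rewrite addnS big_nat_recr ?mulrA ?IH /=; last lia.
by rewrite /gamma_ /= mulrAC divff ?mul1r.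
Qed.

Lemma gamma_mx_prod h k : (forall i, h i != 0) ->
  sdiag h ** \big[smul/sone]_(0 <= i < k) iter i (@Tminus K) (gamma_mx h)
  = sdiag (fun n => h (n + k)%N).
Proof.
move=> h0; under eq_bigr do rewrite Tminus_iter_diag.
have sdiagM : {morph @sdiag K : d e / d * e >-> d ** e}.
  by move=> d e; rewrite smul_diag.
rewrite -(big_morph _ sdiagM (erefl : sdiag 1 = sone)) smul_diag.
congr sdiag; apply/funext => n; rewrite -[RHS]gamma_prod//.
rewrite fct_prodE -[LHS]/(_ * _) -[n.+1]add0n big_addn subSS addKn.
by congr (_ * _); apply: eq_bigr => i _; rewrite addnS addnC.
Qed.

End Diagonals.

(** * Absolutely convergent complex series *)

(* [R[i]] carries no complete normed module structure over itself, so
   [normed_cvg] is applied to the real and imaginary parts. *)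
Section ComplexSeries.
Set Implicit Arguments.
Unset Strict Implicit.
Variable R : realType.
Local Open Scope complex_scope.
Local Notation C := (R[i] : numFieldType).
Implicit Types (u : nat -> C) (x y : C).

Lemma ReB x y : complex.Re (x - y) = complex.Re x - complex.Re y.
Proof. by case: x; case: y. Qed.

Lemma ImB x y : complex.Im (x - y) = complex.Im x - complex.Im y.
Proof. by case: x; case: y. Qed.

Lemma normc_ge_Im x : `|complex.Im x|%:C <= `|x|.
Proof.
case: x => a b; rewrite normc_def lecR /= -sqrtr_sqr ler_wsqrtr//.
by rewrite lerDr sqr_ge0.
Qed.

(** [f] is the real or the imaginary part. Additivity is put on differences because distances use it
    in that form. *)
Lemma series_part (f : C -> R) u : (forall x y, f (x - y) = f x - f y) ->
  f \o series u = series (f \o u).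
Proof.
move=> fB; have f0 : f 0 = 0 by rewrite -(subrr 0) fB subrr.
apply/funext => n; rewrite /series /=; elim/big_rec2: _ => // k a b _ <-.
by rewrite -[b in LHS]opprK fB -[- b]sub0r fB f0 sub0r opprK.
Qed.

Lemma cvg_part (f : C -> R) u (l : C) :
  (forall x y, f (x - y) = f x - f y) -> (forall x, `|f x|%:C <= `|x|) ->
  (u @ \oo --> l -> f \o u @ \oo --> f l)%classic.
Proof.
move=> fB f_le /cvgrPdist_lt ul; apply/cvgrPdist_lt => e e0.
have /ul : 0 < e%:C by rewrite ltcR.
by apply: filterS => n; rewrite -ltcR -fB; apply: le_lt_trans.
Qed.

Lemma is_cvg_series_part (f : C -> R) u :
  (forall x y, f (x - y) = f x - f y) -> (forall x, `|f x|%:C <= `|x|) ->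
  cvgn (series (fun k => `|u k|)) -> cvgn (series (f \o u)).
Proof.
move=> fB f_le /cvg_ex[l ul]; apply: normed_cvg.
(* The norm takes values in [C]; its real part is the real majorant. *)
apply: (@series_le_cvg _ _ (fun k => complex.Re `|u k|)).
- by move=> k; apply: normr_ge0.
- by move=> k; have := normr_ge0 (u k); rewrite lecE => /andP[].
- by move=> k; have := f_le (u k); rewrite lecE => /andP[].
- apply/cvg_ex; exists (complex.Re l).
  have -> := esym (@series_part (@complex.Re R) (fun k => `|u k|) ReB).
  by apply: cvg_part ul; [exact: ReB | exact: normc_ge_Re].
Qed.

Lemma normed_cvg_complex u :
  cvgn (series (fun k => `|u k|)) -> cvgn (series u).
Proof.
move=> uc.
have /cvg_ex[a ua] := is_cvg_series_part ReB (@normc_ge_Re _) uc.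
have /cvg_ex[b ub] := is_cvg_series_part ImB normc_ge_Im uc.
apply/cvg_ex; exists (a +i* b)%C; apply/cvgrPdist_lt => e e0.
(* A positive element of [C] is real, so half of it can be allotted to each part. *)
have ere : e = (complex.Re e)%:C by rewrite RRe_real// gtr0_real.
have e2 : 0 < complex.Re e / 2 by rewrite divr_gt0// -ltcR -ere.
near=> n.
rewrite [e]ere [_ - _]complexE (le_lt_trans (ler_normD _ _))// normrM.
have -> : `|'i| = 1 :> C by rewrite normc_def /= expr0n expr1n add0r sqrtr1.
rewrite mul1r [ltRHS](_ : _ = (complex.Re e / 2)%:C + (complex.Re e / 2)%:C);
  last by rewrite -rmorphD/= -splitr.
rewrite ReB ImB.
rewrite -[complex.Re (series _ _)]/((@complex.Re R \o series u) n).
rewrite -[complex.Im (series _ _)]/((@complex.Im R \o series u) n).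
rewrite (series_part _ ReB) (series_part _ ImB).
rewrite !normc_def/= expr0n/= !addr0 !sqrtr_sqr ltrD// ltcR;
  near: n; [move/cvgrPdist_lt: ua|move/cvgrPdist_lt: ub]; exact.
Unshelve. all: by end_near. Qed.

End ComplexSeries.

(** * Moments *)

Section Moments.
Set Implicit Arguments.
Unset Strict Implicit.
Variables (K : numFieldType) (w : nat -> K).
Hypothesis moments_cvg : forall n, cvgn (series (fun k => k%:R ^+ n * w k : K)).
Implicit Types (p q : {poly K}) (A : smx K).

(** The moment functional of the weight: matrix identities for [G] become identities between its
    values on polynomials. *)
Definition expect p : K := limn (series (fun k => p.[k%:R] * w k : K)).

(** Convergence and value go through one induction, as the limit of a sum splits only once both
    series converge. *)
Lemma expect_sumP (I : Type) (r : seq I) (c : I -> K) (f : I -> {poly K}) :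
  (forall i, cvgn (series (fun k => (f i).[k%:R] * w k))) ->
  cvgn (series (fun k => (\sum_(i <- r) c i *: f i).[k%:R] * w k)) /\
  expect (\sum_(i <- r) c i *: f i) = \sum_(i <- r) c i * expect (f i).
Proof.
move=> fc; elim: r => [|i r [rc rE]].
  have s0 : series (fun k => (\sum_(i <- [::]) c i *: f i).[k%:R] * w k) = cst 0.
    apply/funext => n; rewrite /series /= big1// => k _.
    by rewrite big_nil horner0 mul0r.
  rewrite /expect s0 !big_nil; split; first exact: is_cvg_cst.
  exact: lim_cst.
have sE : series (fun k => (\sum_(j <- i :: r) c j *: f j).[k%:R] * w k) =
    cst (c i) * series (fun k => (f i).[k%:R] * w k)
    + series (fun k => (\sum_(j <- r) c j *: f j).[k%:R] * w k).
  apply/funext => n; rewrite -[RHS]/(_ * _ + _) /series /= mulr_sumr -big_split.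
  by apply: eq_bigr => k _; rewrite big_cons hornerD hornerZ mulrDl mulrA.
have ic : cvgn (cst (c i) * series (fun k => (f i).[k%:R] * w k)).
  by apply: is_cvgM; [exact: is_cvg_cst | exact: fc].
rewrite {1}sE {1}/expect sE; split; first exact: is_cvgD.
rewrite limD// big_cons -rE; congr (_ + _).
by rewrite limM ?lim_cst//; exact: cvg_cst.
Qed.

Lemma expect_cvg p : cvgn (series (fun k => p.[k%:R] * w k)).
Proof.
rewrite -[p]coefK poly_def; apply: (expect_sumP _ _ _).1 => i.
by under eq_fun do rewrite hornerXn; exact: moments_cvg.
Qed.

Lemma expect_sum (I : Type) (r : seq I) (c : I -> K) (f : I -> {poly K}) :
  expect (\sum_(i <- r) c i *: f i) = \sum_(i <- r) c i * expect (f i).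
Proof. by apply: (expect_sumP _ _ _).2 => i; exact: expect_cvg. Qed.

Lemma momentE n : moment w n = expect 'X^n.
Proof. by rewrite /expect; under eq_fun do rewrite hornerXn. Qed.

Lemma expect_pearson (theta sigma q : {poly K}) :
  pearson w theta sigma -> theta.[0] = 0 ->
  expect (theta * q) = expect (sigma * (q \Po ('X + 1))).
Proof.
move=> pw theta0; apply/cvg_lim => //.
(* With partial sums advanced by one, the term at 0 splits off and vanishes by [theta.[0] = 0]; the
   others sit at [k.+1], where Pearson's equation applies. *)
rewrite -cvg_shiftS.
have -> : [sequence series (fun k => (theta * q).[k%:R] * w k) n.+1]_n
    = series (fun k => (sigma * (q \Po ('X + 1))).[k%:R] * w k).
  apply/funext => n; rewrite /series /= big_nat_recl// hornerM theta0 !mul0r add0r.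
  apply: eq_bigr => k _; rewrite !hornerM mulrAC pw horner_comp !hornerE.
  by rewrite mulrAC natr1.
exact: expect_cvg.
Qed.

Let G := moment_mx w.

Lemma moment_hankel : sshift ** G = G ** sshift^tr.
Proof.
apply: smxP => n m; rewrite smul_shiftl.
rewrite -[RHS]/((G ** sshift^tr)^tr m n) strmx_mul smul_shiftl.
by rewrite /strmx /G /moment_mx addSnnS.
Qed.

(** Raising the row index of [G] by one multiplies the integrand by ['X]. *)
Lemma eval_shift_moment p n m :
  (speval p sshift ** G) n m = expect (p * 'X^(n + m)).
Proof.
rewrite speval_mul; last exact: hess_row_finite (hess_shift K).
rewrite -[in RHS](coefK p) poly_def mulr_suml.
under [in RHS]eq_bigr do rewrite -scalerAl -exprD.
rewrite expect_sum; apply: eq_bigr => k _.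
by rewrite smul_shift_pow /G /moment_mx momentE addnCA addnA.
Qed.

Lemma exprD1n n : ('X + 1) ^+ n = \sum_(k < n.+1) 'C(n, k)%:R *: 'X^k :> {poly K}.
Proof.
rewrite addrC exprDn; apply: eq_bigr => k _.
by rewrite expr1n mul1r scaler_nat.
Qed.

Lemma pascal_mulE A n m :
  (pascal K ** A) n m = \sum_(k < n.+1) 'C(n, k)%:R * A k m.
Proof.
by rewrite (@smul_nat_row _ _ _ n.+1) => [//|k nk]; rewrite /pascal bin_small.
Qed.

Lemma moment_pearson (theta sigma : {poly K}) :
  pearson w theta sigma -> theta.[0] = 0 ->
  pascal K ** speval sigma sshift ** G ** (pascal K)^tr = speval theta sshift ** G.
Proof.
move=> pw theta0; apply: smxP => n m.
have rfL := row_finite_eval sigma (hess_row_finite (hess_shift K)).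
have rfB := hess_row_finite (hess_pascal K).
rewrite eval_shift_moment (expect_pearson _ pw)// rmorphXn /= comp_polyX.
have cfB : col_finite (pascal K)^tr := rfB.
(* Of the power [n + m] of ['X + 1], the left Pascal factor expands the part [n] and the transposed
   right one the part [m]. *)
rewrite -(smulA_rr _ rfB rfL) -(smulA_rc _ rfB cfB) pascal_mulE exprD {1}exprD1n.
rewrite mulrCA mulr_suml; under [in RHS]eq_bigr do rewrite -scalerAl.
rewrite expect_sum; apply: eq_bigr => i _; congr (_ * _).
rewrite -[LHS]/((speval sigma sshift ** G ** (pascal K)^tr)^tr m i) strmx_mul.
rewrite pascal_mulE exprD1n !mulr_sumr.
under [in RHS]eq_bigr do rewrite -!scalerAr.
rewrite expect_sum; apply: eq_bigr => j _; congr (_ * _).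
by rewrite /strmx eval_shift_moment exprD mulrCA.
Qed.

End Moments.

(** * The structure matrix *)

Section Structure.
Set Implicit Arguments.
Unset Strict Implicit.
Variables (K : fieldType) (G S : smx K) (h : nat -> K).
Hypothesis uS : lower_unitriangular S.
Hypothesis h0 : forall n, h n != 0.
Hypothesis GE : G = sinv S ** sdiag h ** (sinv S)^tr.
Hypothesis hankel : sshift ** G = G ** sshift^tr.

Local Notation H := (sdiag h).
Local Notation J := (jacobi S).
Local Notation Pi := (dressed_pascal S).

Let rfH : row_finite H. Proof. exact: row_finite_diag. Qed.

Let rfS : row_finite S.
Proof. by have /hess_unitriangular/hess_row_finite := uS. Qed.

Let rfSi : row_finite (sinv S).
Proof. by have [/hess_row_finite] := sinv_unitriangular uS. Qed.

Let cfSt : col_finite S^tr. Proof. exact: rfS. Qed.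

Let rfL : row_finite (sshift : smx K).
Proof. exact: hess_row_finite (hess_shift K). Qed.

Let rfB : row_finite (pascal K).
Proof. exact: hess_row_finite (hess_pascal K). Qed.

Lemma hess_dress a c A : hessenberg a c A -> hessenberg a c (S ** A ** sinv S).
Proof.
move=> hA; have /hess_unitriangular hS := uS.
have [hSi _ _] := sinv_unitriangular uS.
by have := hess_mul (hess_mul hS hA) hSi; rewrite add0n addn0 mul1r mulr1.
Qed.

Lemma hess_jacobi : hessenberg 1 1 J.
Proof. exact: hess_dress (hess_shift K). Qed.

Lemma hess_dressed_pascal : hessenberg 0 1 Pi.
Proof. exact: hess_dress (hess_pascal K). Qed.

Let rfJ : row_finite J. Proof. exact: hess_row_finite hess_jacobi. Qed.
Let rfPi : row_finite Pi.
Proof. exact: hess_row_finite hess_dressed_pascal. Qed.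
Let cfPit : col_finite Pi^tr. Proof. exact: rfPi. Qed.

(** It gives dressed matrices the intertwining form [A' ** S = S ** A], which passes to
    polynomials. *)
Lemma dress_mul A : row_finite A -> S ** A ** sinv S ** S = S ** A.
Proof.
move=> rfA; have [_ _ SiS] := sinv_unitriangular uS.
by rewrite -smulA_rr ?SiS ?smulr1//; exact: row_finite_mul.
Qed.

Lemma jacobi_mul : J ** S = S ** sshift. Proof. exact: dress_mul. Qed.

Lemma dressed_pascal_mul : Pi ** S = S ** pascal K. Proof. exact: dress_mul. Qed.

Lemma eval_jacobi_mul p : speval p J ** S = S ** speval p sshift.
Proof. by apply: speval_intertwine jacobi_mul => //; left. Qed.

Lemma cholesky_sym : G^tr = G.
Proof.
rewrite GE (strmx_mul (sinv S ** H) (sinv S)^tr) (strmx_mul (sinv S) H).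
by rewrite strmx_diag strmxK smulA_rr.
Qed.

Lemma dress_moment : S ** G ** S^tr = H.
Proof.
have [_ SSi _] := sinv_unitriangular uS.
rewrite GE smulA_rr//; last exact: row_finite_mul.
rewrite (smulA_rr H rfS rfSi) SSi smul1.
rewrite -smulA_rc// -(strmx_mul S (sinv S)) SSi strmx1; exact: smulr1.
Qed.

(** Moving [A] across [S] leaves [S ** G ** S^tr], which is [H]; moment identities thus become
    identities between dressed matrices. *)
Lemma conj_moment A A' : row_finite A -> row_finite A' -> A' ** S = S ** A ->
  S ** (A ** G) ** S^tr = A' ** H.
Proof.
move=> rfA rfA' AS; rewrite (smulA_rr _ rfS rfA) -AS -(smulA_rr _ rfA' rfS).
by rewrite -smulA_rc// dress_moment.
Qed.

(** [J ** H] is [sshift ** G] conjugated by [S], and [sshift ** G] is symmetric because [G] is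
    Hankel and symmetric. *)
Lemma jacobi_sym : J ** H = H ** J^tr.
Proof.
have JE := conj_moment rfL rfJ jacobi_mul.
rewrite -{1}JE hankel -[LHS]strmxK.
have -> : (S ** (G ** sshift^tr) ** S^tr)^tr = S ** (sshift ** G) ** S^tr.
  rewrite (strmx_mul _ S^tr) (strmx_mul S) (strmx_mul G) cholesky_sym !strmxK.
  by rewrite smulA_rc.
by rewrite JE (strmx_mul J H) strmx_diag.
Qed.

Lemma eval_jacobi_sym p : speval p J ** H = H ** speval p J^tr.
Proof. by apply: speval_intertwine jacobi_sym => //; right. Qed.

Lemma dress_comp A C : row_finite A -> row_finite C ->
  S ** A ** sinv S ** (S ** C ** sinv S) = S ** (A ** C) ** sinv S.
Proof.
move=> rfA rfC; have rfSA := row_finite_mul rfS rfA.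
have rfSASi := row_finite_mul rfSA rfSi; have rfSC := row_finite_mul rfS rfC.
by rewrite smulA_rr// smulA_rr// dress_mul// -(smulA_rr C rfS rfA).
Qed.

Lemma jacobi_pascal : J ** Pi = Pi ** J + Pi.
Proof.
rewrite dress_comp// shift_pascal smulDr// smulr1 smulDr// smulDl ?dress_comp//.
  exact/row_finite_mul/row_finite_mul.
exact: row_finite_mul.
Qed.

Let uPi : lower_unitriangular Pi.
Proof. by apply/hess_unitriangular; exact: hess_dressed_pascal. Qed.

Let hPii : hessenberg 0 1 (sinv Pi).
Proof. by have [] := sinv_unitriangular uPi. Qed.

Let rfPii : row_finite (sinv Pi).
Proof. exact: hess_row_finite hPii. Qed.

Let PiK : Pi ** sinv Pi = sone.
Proof. by have [] := sinv_unitriangular uPi. Qed.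

Let KPi : sinv Pi ** Pi = sone.
Proof. by have [] := sinv_unitriangular uPi. Qed.

Let rf1 : row_finite (sone : smx K). Proof. exact: row_finite_diag. Qed.

Lemma jacobi_pascal_inv : (J + sone) ** sinv Pi = sinv Pi ** J.
Proof.
have rfJ1 : row_finite (J + sone) by exact: row_finite_add.
have JPi : J ** Pi = Pi ** (J + sone) by rewrite jacobi_pascal smulDr// smulr1.
rewrite -[RHS]smulr1 -[in RHS]PiK smulA_rr//; last exact: row_finite_mul.
rewrite -(smulA_rr Pi rfPii rfJ) JPi (smulA_rr _ rfPii rfPi) KPi.
by rewrite smul1.
Qed.

Lemma eval_jacobi_pascal_inv p :
  speval p (J + sone) ** sinv Pi = sinv Pi ** speval p J.
Proof.
apply: speval_intertwine jacobi_pascal_inv; last by left.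
exact: row_finite_add.
Qed.

Lemma eval_jacobi_pascal p :
  speval p (J - sone) ** Pi = Pi ** speval p J.
Proof.
have rfJ1 : row_finite (J - sone) by exact/row_finite_add/row_finite_opp.
apply: speval_intertwine => //; first by left.
apply: (@addIr _ Pi).
by rewrite -jacobi_pascal -[in LHS](smul1 Pi) -{2}(smul1 Pi) smul1 -smulDl// subrK.
Qed.

(** * The equal expressions of [Psi] *)

Variables theta sigma : {poly K}.
Hypothesis pearson_mx :
  pascal K ** speval sigma sshift ** G ** (pascal K)^tr = speval theta sshift ** G.

Local Notation Psi := (sinv Pi ** H ** speval theta J^tr).

Let rfp p : row_finite (speval p J). Proof. exact: row_finite_eval. Qed.

Lemma pearson_dressed :
  Pi ** speval sigma J ** H ** Pi^tr = speval theta J ** H.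
Proof.
rewrite -(conj_moment _ _ (eval_jacobi_mul theta)) -?pearson_mx//; last first.
  exact: row_finite_eval.
have rfsL := row_finite_eval sigma rfL.
have PsS : Pi ** speval sigma J ** S = S ** (pascal K ** speval sigma sshift).
  rewrite -smulA_rr// eval_jacobi_mul smulA_rr// dressed_pascal_mul.
  by rewrite smulA_rr.
have cfBt : col_finite (pascal K)^tr := rfB.
rewrite -(conj_moment _ _ PsS); try exact: row_finite_mul.
(* The right Pascal factor crosses [S^tr] by the transpose of [Pi ** S = S ** pascal K]. *)
rewrite (smulA_rc (_ ** G) rfS cfBt) -(smulA_cc (S ** _) cfBt cfSt).
rewrite -(strmx_mul S (pascal K)) -dressed_pascal_mul (strmx_mul Pi S).
by rewrite (smulA_cc _ cfSt cfPit).
Qed.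

Lemma structure_theta : Psi = sinv Pi ** speval theta J ** H.
Proof.
by rewrite -(smulA_rr _ rfPii rfH) -eval_jacobi_sym smulA_rr.
Qed.

Lemma structure_sigma : Psi = speval sigma J ** H ** Pi^tr.
Proof.
rewrite structure_theta -smulA_rr// -pearson_dressed.
rewrite -(smulA_rr H rfPi (rfp sigma)) smulA_rc//.
by rewrite (smulA_rr _ rfPii rfPi) KPi smul1.
Qed.

Lemma structure_sigma_tr : Psi = H ** speval sigma J^tr ** Pi^tr.
Proof. by rewrite structure_sigma eval_jacobi_sym. Qed.

Lemma structure_theta_shift : Psi = speval theta (J + sone) ** sinv Pi ** H.
Proof. by rewrite structure_theta eval_jacobi_pascal_inv. Qed.

(** This is [eval_jacobi_pascal] transposed and applied to [structure_sigma_tr]. *)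
Lemma structure_sigma_shift : Psi = H ** Pi^tr ** speval sigma (J^tr - sone).
Proof.
have rfJ1 : row_finite (J - sone) by exact/row_finite_add/row_finite_opp.
have J1E : J^tr - sone = (J - sone)^tr.
  by apply: smxP => n m; rewrite -[LHS]/(J m n - sone n m) -[in LHS]strmx1.
have cfs : col_finite (speval sigma (J - sone))^tr.
  exact: (@row_finite_eval _ (J - sone)).
rewrite structure_sigma_tr J1E -(strmx_eval sigma rfJ1) -(smulA_rc Pi^tr rfH cfs).
rewrite -(strmx_mul _ Pi) eval_jacobi_pascal (strmx_mul Pi).
by rewrite (strmx_eval sigma rfJ) smulA_rc.
Qed.

(** The transpose has the shape of [structure_theta], so the subdiagonals of [Psi] are handled like
    its superdiagonals. *)
Lemma structure_tr : Psi^tr = Pi ** speval sigma J ** H.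
Proof.
rewrite structure_sigma_tr -strmx_eval//.
rewrite (strmx_mul (H ** _) Pi^tr) (strmx_mul H) strmx_diag !strmxK.
by rewrite smulA_rr.
Qed.

(** * Band structure of [Psi] *)

Lemma hess_structure_theta s : size theta = s.+1 ->
  hessenberg s (lead_coef theta) (sinv Pi ** speval theta J).
Proof.
move=> /(hess_eval hess_jacobi) hth.
by have := hess_mul hPii hth; rewrite mul1r add0n.
Qed.

Lemma hess_structure_sigma s : size sigma = s.+1 ->
  hessenberg s (lead_coef sigma) (Pi ** speval sigma J).
Proof.
move=> /(hess_eval hess_jacobi) hs.
by have := hess_mul hess_dressed_pascal hs; rewrite mul1r add0n.
Qed.

Lemma structure_upper_entry n m :
  Psi n m = (sinv Pi ** speval theta J) n m * h m.
Proof. by rewrite structure_theta smul_diagr. Qed.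

Lemma structure_lower_entry n m :
  Psi n m = (Pi ** speval sigma J) m n * h n.
Proof. by rewrite -[LHS]/(Psi^tr m n) structure_tr smul_diagr. Qed.

Lemma structure_upper_diagonal s n : size theta = s.+1 ->
  Psi n (n + s)%N = lead_coef theta * h (n + s)%N.
Proof. by move=> /hess_structure_theta[_ tE]; rewrite structure_upper_entry tE. Qed.

Lemma structure_lower_diagonal s n : size sigma = s.+1 ->
  Psi (n + s)%N n = lead_coef sigma * h (n + s)%N.
Proof. by move=> /hess_structure_sigma[_ sE]; rewrite structure_lower_entry sE. Qed.

Lemma structure_band a b : size sigma = a.+1 -> size theta = b.+1 ->
  Psi = \sum_(1 <= k < a.+1) (sshift^tr ^^ k ** sdiag (band_diagonal Psi (- k%:Z)))
      + sdiag (band_diagonal Psi 0)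
      + \sum_(1 <= k < b.+1) (sdiag (band_diagonal Psi k%:Z) ** sshift ^^ k).
Proof.
move=> /hess_structure_sigma[s0 _] /hess_structure_theta[t0 _].
apply: band_expansion => n m nm.
  by rewrite structure_lower_entry s0 ?mul0r.
by rewrite structure_upper_entry t0 ?mul0r.
Qed.

(** * The extreme diagonals *)

Local Notation Jm := (strict_lower J).

Let rfJm : row_finite Jm.
Proof. by move=> n; exists n => k nk; rewrite /strict_lower ltnNge nk. Qed.

(** By symmetry of [J ** H], the part of [J] below the diagonal mirrors its unit superdiagonal,
    weighted by [h]. *)
Lemma jacobi_lower : Jm ** H = H ** sshift^tr.
Proof.
apply: smxP => n m; rewrite smul_diagr smul_diagl /strict_lower /strmx.
have JE : J n m * h m = h n * J m n.
  by rewrite -smul_diagr jacobi_sym smul_diagl.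
have [J0 J1] := hess_jacobi.
rewrite /sshift; case: ltngtP => mn; rewrite ?mul0r ?mulr0 //.
- case: eqP => nm; first by rewrite JE nm -[m.+1]addn1 J1.
  by rewrite JE J0 ?mulr0//; lia.
- by rewrite [n == _](_ : _ = false) ?mulr0//; lia.
- by rewrite mn [_ == _](_ : _ = false) ?mulr0//; lia.
Qed.

Lemma jacobi_lower_pow k : Jm ^^ k ** H = H ** sshift^tr ^^ k.
Proof.
by apply: spow_intertwine jacobi_lower => //; right; rewrite /col_finite strmxK.
Qed.

Lemma structure_lower_diagonal_pow s : size sigma = s.+1 ->
  sshift^tr ^^ s ** sdiag (band_diagonal Psi (- s%:Z))
  = sscale (lead_coef sigma) (Jm ^^ s ** H).
Proof.
move=> ssig; rewrite jacobi_lower_pow -(strmx_pow s rfL); apply: smxP => n m.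
rewrite smul_diagr band_diagonalN structure_lower_diagonal//.
rewrite /sscale smul_diagl /strmx shift_powE.
by case: eqP => [->|_]; rewrite ?mulr1 ?mul1r// !mulr0 mul0r.
Qed.

Lemma structure_upper_diagonal_pow s : size theta = s.+1 -> theta \is monic ->
  sdiag (band_diagonal Psi s%:Z) ** sshift ^^ s = H ** Jm^tr ^^ s.
Proof.
move=> sth /monicP lth; rewrite -(strmx_pow s rfJm).
have -> : H ** (Jm ^^ s)^tr = (Jm ^^ s ** H)^tr.
  by rewrite (strmx_mul _ H) strmx_diag.
rewrite jacobi_lower_pow -(strmx_pow s rfL); apply: smxP => n m.
rewrite smul_diagl -[band_diagonal _ _ _]/(Psi n (n + s)%N).
rewrite structure_upper_diagonal// lth mul1r.
rewrite /strmx smul_diagl shift_powE.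
by case: eqP => [->|_]; rewrite ?mulr0.
Qed.

(** * The structure equations *)

(* A vector is stored as a matrix with all columns equal, so that products with
   vectors are products of matrices. *)
Definition cols (x : nat -> K) : smx K := fun n _ => x n.

Local Notation X z := (S ** cols (monomials z)).

(** The shift multiplies the monomial vector by [z]. The eigenvalue is a scalar matrix on the right,
    as [spow_intertwine] requires. *)
Lemma jacobi_eigen z : J ** X z = X z ** sdiag (fun=> z).
Proof.
rewrite smulA_rr// jacobi_mul -smulA_rr//.
rewrite -(smulA_rc (cols (monomials z)) rfS (@col_finite_diag _ _)); congr (S ** _).
apply: smxP => n m; rewrite smul_shiftl smul_diagr.
by rewrite /cols /monomials exprSr.
Qed.

Lemma eval_jacobi_eigen p z : speval p J ** X z = X z ** sdiag (fun=> p.[z]).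
Proof.
apply: smxP => n m; rewrite speval_mul// smul_diagr horner_coef mulr_sumr.
apply: eq_bigr => k _; rewrite mulrCA; congr (_ * _).
rewrite (spow_intertwine k rfJ _ (jacobi_eigen z)); last first.
  by right; exact: col_finite_diag.
suff -> : sdiag (fun=> z) ^^ k = sdiag (fun=> z ^+ k) by rewrite smul_diagr.
elim: (k : nat) => // j /= ->; rewrite smul_diag; congr sdiag.
by apply/funext => i; rewrite exprS.
Qed.

(** On the monomial vector this is the binomial theorem. *)
Lemma pascal_eigen z : Pi ** X z = X (z + 1).
Proof.
rewrite smulA_rr// dressed_pascal_mul -smulA_rr//; congr (S ** _).
apply: smxP => n m; rewrite (@smul_nat_row _ _ _ n.+1) => [|k nk]; last first.
  by rewrite /pascal bin_small.
rewrite /cols /monomials addrC exprDn; apply: eq_bigr => k _.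
by rewrite expr1n mul1r /pascal mulr_natl.
Qed.

Lemma pascal_inv_eigen z : sinv Pi ** X z = X (z - 1).
Proof.
by rewrite -[z in LHS](subrK 1) -pascal_eigen smulA_rr// KPi smul1.
Qed.

Lemma diag_mul_inv A : row_finite A -> A ** H ** sinv H = A.
Proof.
move=> rfA; rewrite sinv_diag// -smulA_rr// smul_diag.
rewrite (_ : h * _ = 1) ?[sdiag _]/sone; first exact: smulr1.
by apply/funext => n; rewrite -[LHS]/(h n * (h n)^-1) divff.
Qed.

Lemma structure_eq_theta z :
  (fun n => theta.[z] * orth_poly S (z - 1) n)
  = smulv (Psi ** sinv H) (orth_poly S z).
Proof.
rewrite structure_theta diag_mul_inv; last exact: row_finite_mul.
(* All columns of [X z] agree; column 0 represents the vector. *)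
apply/funext => n; rewrite -[RHS]/((_ ** X z) n 0) -smulA_rr// eval_jacobi_eigen.
rewrite (smulA_rc (X z) rfPii (@col_finite_diag _ _)) pascal_inv_eigen.
by rewrite smul_diagr mulrC.
Qed.

Lemma structure_eq_sigma z :
  (fun n => sigma.[z] * orth_poly S (z + 1) n)
  = smulv (Psi^tr ** sinv H) (orth_poly S z).
Proof.
rewrite structure_tr diag_mul_inv; last exact: row_finite_mul.
apply/funext => n; rewrite -[RHS]/((_ ** X z) n 0) -smulA_rr// eval_jacobi_eigen.
rewrite (smulA_rc (X z) rfPi (@col_finite_diag _ _)) pascal_eigen.
by rewrite smul_diagr mulrC.
Qed.

End Structure.

Theorem theorem2 (R : realType) (w : nat -> R[i]) (theta sigma : {poly R[i]})
  (N M : nat) (eta : R[i]) (S : smx R[i]) (h : nat -> R[i])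
  (hmom : has_finite_moments w)
  (hminors : forall n : nat, leading_minor (moment_mx w) n != 0)
  (hchol : cholesky (moment_mx w) S h)
  (hpearson : pearson w theta sigma)
  (htheta0 : theta.[0] = 0)
  (htheta_deg : size theta = N.+2)
  (htheta_monic : theta \is monic)
  (hsigma_deg : size sigma = M.+1)
  (hsigma_lead : lead_coef sigma = eta) :
  let H := sdiag h in
  let J := jacobi S in
  let Pi := dressed_pascal S in
  let L := sshift in
  let Jm := strict_lower J in
  let gam := gamma_mx h in
  let P := orth_poly S in
  let Psi := sinv Pi ** H ** speval theta J^tr in
  [/\ [/\ Psi = speval sigma J ** H ** Pi^tr,
          Psi = sinv Pi ** speval theta J ** H,
          Psi = H ** speval sigma J^tr ** Pi^tr,
          Psi = speval theta (J + sone) ** sinv Pi ** H &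
          Psi = H ** Pi^tr ** speval sigma (J^tr - sone)],
      exists psi : int -> nat -> R[i],
      [/\ Psi = \sum_(1 <= k < M.+1) (L^tr ^^ k ** sdiag (psi (- k%:Z)))
                + sdiag (psi 0)
                + \sum_(1 <= k < N.+2) (sdiag (psi k%:Z) ** L ^^ k),
          L^tr ^^ M ** sdiag (psi (- M%:Z)) = eta *:: (Jm ^^ M ** H),
          [/\ sdiag (psi (- M%:Z))
              = eta *:: (H ** \big[smul/sone]_(0 <= k < M) iter k (@Tminus _) gam)
            & sdiag (psi (- M%:Z))
              = eta *:: sdiag (fun n =>
                          h n * \prod_(n.+1 <= k < (n + M).+1) gamma_ h k)],
          sdiag (psi N.+1%:Z) ** L ^^ N.+1 = H ** Jm^tr ^^ N.+1 &
          [/\ sdiag (psi N.+1%:Z)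
              = H ** \big[smul/sone]_(0 <= k < N.+1) iter k (@Tminus _) gam
            & sdiag (psi N.+1%:Z)
              = sdiag (fun n =>
                  h n * \prod_(n.+1 <= k < (n + N.+1).+1) gamma_ h k)]] &
      forall z : R[i],
        (fun n => theta.[z] * P (z - 1) n) = smulv (Psi ** sinv H) (P z) /\
        (fun n => sigma.[z] * P (z + 1) n) = smulv (Psi^tr ** sinv H) (P z)].
Proof.
move=> H J Pi L Jm gam P Psi; case: hchol => uS h0 GE.
have mom n := normed_cvg_complex (hmom n).
have hank := moment_hankel w.
have pear := moment_pearson mom hpearson htheta0.
have eE : lead_coef theta = 1 by exact/monicP.
split.
- split.
  + exact: (structure_sigma uS GE hank pear).
  + exact: (structure_theta uS GE hank).
  + exact: (structure_sigma_tr uS GE hank pear).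
  + exact: (structure_theta_shift uS GE hank).
  + exact: (structure_sigma_shift uS GE hank pear).
- exists (band_diagonal Psi); split.
  + exact: (structure_band uS GE hank pear hsigma_deg htheta_deg).
  + rewrite -hsigma_lead.
    exact: (structure_lower_diagonal_pow uS GE hank pear hsigma_deg).
  (* Both product forms telescope to [h (n + M)], so the diagonal is first brought to that value. *)
  + have lowE : sdiag (band_diagonal Psi (- M%:Z))
        = sscale eta (sdiag (fun n => h (n + M)%N)).
      apply: smxP => n m; rewrite /sscale /sdiag band_diagonalN.
      rewrite /Psi (structure_lower_diagonal uS GE hank pear _ hsigma_deg).
      by rewrite hsigma_lead; case: eqP => // _; rewrite mulr0.
    rewrite lowE /H /gam (gamma_mx_prod M h0); split=> //.
    by congr (sscale _ (sdiag _)); apply/funext => n; rewrite gamma_prod.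
  + exact: (structure_upper_diagonal_pow uS GE hank htheta_deg htheta_monic).
  + have upE : sdiag (band_diagonal Psi N.+1%:Z) = sdiag (fun n => h (n + N.+1)%N).
      congr sdiag; apply/funext => n; rewrite -[LHS]/(Psi n (n + N.+1)%N).
      rewrite /Psi (structure_upper_diagonal uS GE hank _ htheta_deg).
      by rewrite eE mul1r.
    rewrite upE /H /gam (gamma_mx_prod N.+1 h0); split=> //.
    by congr sdiag; apply/funext => n; rewrite gamma_prod.
- move=> z; split.
  + exact: (structure_eq_theta uS h0 GE hank theta z).
  + exact: (structure_eq_sigma uS h0 GE hank pear z).
Qed.
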